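(* Let $R$ be a ring. Then $R$ is uniquely weakly D-nil-clean if and only if $R$ is a D-ring, or the following three conditions all hold: (1) $R$ is abelian; (2) $R$ is periodic; (3) $R/J(R)$ is isomorphic to one of the following: (a) a field $F$; (b) $\mathbb{Z}_3\oplus\mathbb{Z}_3$; (c) $\mathbb{Z}_3\oplus B$ where $B$ is a Boolean ring; or (d) a Boolean ring.
   Context: All rings are associative with identity, not necessarily commutative. $J(R)$ is the Jacobson radical of $R$, and $\mathbb{Z}_3=\mathbb{Z}/3\mathbb{Z}$. An element $a\in R$ is a zero-divisor if there exist nonzero $b,c\in R$ with $ab=0=ca$. An element $e\in R$ is a very idempotent if $e$ or $-e$ is an idempotent. An element $a\in R$ is weakly nil-clean if it is the sum of a nilpotent element and a very idempotent; it is uniquely weakly nil-clean if it is weakly nil-clean and, whenever $a=w_1+e_1=w_2+e_2$ with $w_1,w_2$ nilpotent and $e_1,e_2$ very idempotents, one has $e_1^2=e_2^2$. $R$ is uniquely weakly D-nil-clean if every zero-divisor in $R$ is uniquely weakly nil-clean. $R$ is a D-ring if every zero-divisor in $R$ is nilpotent. $R$ is abelian if every idempotent of $R$ is central. $R$ is periodic if for any $a\in R$ there exist distinct $m,n\in\mathbb{N}$ with $a^m=a^n$. A ring is Boolean if every element is an idempotent. *)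

(* Defs.v *)
From HB Require Import structures.
From mathcomp Require Import all_boot all_algebra.
From mathcomp Require Import boolp classical_sets.

Set Implicit Arguments.
Unset Strict Implicit.
Unset Printing Implicit Defensive.

Import GRing.Theory.
Local Open Scope ring_scope.
Local Open Scope quotient_scope.
Local Open Scope classical_set_scope.

(* All rings are pzRingTypes: associative, with identity, not necessarily
   commutative, and possibly trivial. *)

Section Elements.
Variable R : pzRingType.
Implicit Types a b c e w : R.

Definition zero_divisor a : Prop :=
  exists b c, [/\ b != 0, c != 0, a * b = 0 & c * a = 0].

Definition nilpotent_elt a : Prop := exists n : nat, a ^+ n = 0.

Definition idempotent_elt e : Prop := e * e = e.

Definition very_idempotent e : Prop :=
  idempotent_elt e \/ idempotent_elt (- e).

Definition weakly_nil_clean a : Prop :=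
  exists w e, [/\ nilpotent_elt w, very_idempotent e & a = w + e].

Definition uniquely_weakly_nil_clean a : Prop :=
  weakly_nil_clean a /\
  forall w1 e1 w2 e2,
    nilpotent_elt w1 -> very_idempotent e1 -> a = w1 + e1 ->
    nilpotent_elt w2 -> very_idempotent e2 -> a = w2 + e2 ->
    e1 ^+ 2 = e2 ^+ 2.

End Elements.

Section Rings.
Variable R : pzRingType.

Definition uniquely_weakly_D_nil_clean : Prop :=
  forall a : R, zero_divisor a -> uniquely_weakly_nil_clean a.

Definition D_ring : Prop := forall a : R, zero_divisor a -> nilpotent_elt a.

Definition abelian_ring : Prop :=
  forall e : R, idempotent_elt e -> forall r : R, e * r = r * e.

(* Allowing m = 0 or n = 0 is harmless: multiply a ^+ m = a ^+ n by a. *)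
Definition periodic_ring : Prop :=
  forall a : R, exists m n : nat, m <> n /\ a ^+ m = a ^+ n.

Definition boolean_ring : Prop := forall a : R, idempotent_elt a.

End Rings.

Definition ring_isomorphic (A B : pzRingType) : Prop :=
  exists f : {rmorphism A -> B}, bijective f.

Section Jacobson.
Variable R : pzRingType.

Definition left_ideal (I : set R) : Prop :=
  [/\ I 0, forall x y, I x -> I y -> I (x - y) & forall r x, I x -> I (r * x)].

Definition maximal_left_ideal (M : set R) : Prop :=
  [/\ left_ideal M, M <> setT &
      forall I, left_ideal I -> M `<=` I -> I = M \/ I = setT].

Definition jacobson : pred R :=
  fun x => x \in \bigcap_(M in maximal_left_ideal) M.

Lemma jacobsonP x :
  reflect (forall M, maximal_left_ideal M -> M x) (x \in jacobson).
Proof.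
rewrite unfold_in /jacobson.
by apply: (iffP idP) => [/set_mem xJ M /xJ //|xJ]; apply: mem_set => M /xJ.
Qed.

Lemma jacobson_zmod_closed : zmod_closed jacobson.
Proof.
split=> [|x y /jacobsonP xJ /jacobsonP yJ]; apply/jacobsonP => M maxM.
  by case: maxM => [[]].
by have [[_ MB _] _ _] := maxM; apply: MB; [exact: xJ|exact: yJ].
Qed.

HB.instance Definition _ := GRing.isZmodClosed.Build R jacobson
  jacobson_zmod_closed.
Local Notation J := (GRing.ZmodClosed.clone R jacobson _).

Lemma jacobsonMl r x : x \in jacobson -> r * x \in jacobson.
Proof.
move=> /jacobsonP xJ; apply/jacobsonP => M maxM.
by have [[_ _ MM] _ _] := maxM; apply: MM; exact: xJ.
Qed.

(* For a maximal left ideal M, the left ideal [set x | M (x * r)] is the whole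
   ring if M r, and is maximal otherwise. *)
Lemma jacobsonMr r x : x \in jacobson -> x * r \in jacobson.
Proof.
move=> /jacobsonP xJ; apply/jacobsonP => M maxM.
have [[M0 MB MM] MnT Mmax] := maxM.
have [Mr|nMr] := pselect (M r); first exact: MM.
have MD y z : M y -> M z -> M (y + z).
  by move=> My Mz; rewrite -[z]opprK; apply: (MB) => //; rewrite -sub0r; apply: MB.
suff : maximal_left_ideal [set y | M (y * r)] by move/xJ.
split.
- split=> [|y z|s y] /=; first by rewrite mul0r.
  + by rewrite mulrBl; apply: MB.
  + by rewrite -mulrA; apply: MM.
- by move=> eT; apply: nMr; rewrite -[r]mul1r -[M _]/([set y | M (y * r)] 1) eT.
move=> I [I0 IB IM] sMI.
have ID y z : I y -> I z -> I (y + z).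
  by move=> Iy Iz; rewrite -[z]opprK; apply: (IB) => //; rewrite -sub0r; apply: IB.
have [sIM|] := pselect (I `<=` [set y | M (y * r)]).
  by left; apply/seteqP.
move=> /existsNP[z /not_implyP[Iz nMz]]; right.
pose K : set R := [set y | exists m i, [/\ M m, I i & y = m + i * r]].
have idK : left_ideal K.
  split.
  - by exists 0, 0; rewrite mul0r addr0.
  - move=> _ _ [m [i [Mm Ii ->]]] [m' [i' [Mm' Ii' ->]]].
    exists (m - m'), (i - i'); split; [exact: MB|exact: IB|].
    by rewrite mulrBl opprD addrACA.
  - move=> s _ [m [i [Mm Ii ->]]]; exists (s * m), (s * i).
    by split; [exact: MM|exact: IM|rewrite mulrDr mulrA].
have sMK : M `<=` K by move=> m Mm; exists m, 0; rewrite mul0r addr0.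
have [KM|KT] := Mmax K idK sMK.
  case: nMz; rewrite /= -KM; exists 0, z; split => //; by rewrite add0r.
have [m [i [Mm Ii rE]]] : K r by rewrite KT.
have I1 : I 1.
  rewrite -(subrK i 1); apply: ID => //; apply: sMI => /=.
  by rewrite mulrBl mul1r {1}rE addrK.
by apply/seteqP; split=> // y _; rewrite -[y]mulr1; apply: IM.
Qed.

(* The additive group R / J(R) is the library's quotient; the multiplication is
   added here because the library only does so for commutative R. *)
Definition jacobson_quot : Type := Quotient.quot J.
Local Notation Q := jacobson_quot.

HB.instance Definition _ := GRing.Zmodule.on Q.
HB.instance Definition _ : EqQuotient R (Quotient.equiv J) Q :=
  EqQuotient.on Q.
HB.instance Definition _ :=
  @isZmodQuotient.Build R (Quotient.equiv J) 0 -%R +%R Q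
    (@pi_zeror _ _ _ _ _ (Quotient.quot J))
    (@pi_oppr _ _ _ _ _ (Quotient.quot J))
    (@pi_addr _ _ _ _ _ (Quotient.quot J)).

Definition jacobson_quot_one : Q := \pi_Q 1.
Definition jacobson_quot_mul : Q -> Q -> Q := lift_op2 Q *%R.

Lemma jacobson_quot_eqP x y :
  reflect (\pi_Q x = \pi_Q y) (x - y \in jacobson).
Proof. by rewrite Quotient.idealrBE; apply: eqP. Qed.

Lemma pi_jacobson_quot_mul :
  {morph \pi_Q : x y / x * y >-> jacobson_quot_mul x y}.
Proof.
move=> x y; unlock jacobson_quot_mul; apply/jacobson_quot_eqP.
set x' := repr _; set y' := repr _.
have xJ : x - x' \in jacobson by apply/jacobson_quot_eqP; rewrite reprK.
have yJ : y - y' \in jacobson by apply/jacobson_quot_eqP; rewrite reprK.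
rewrite -[x * y](subrK (x * y')) -addrA -mulrBr -mulrBl.
by apply: (@rpredD _ J); [exact: jacobsonMl|exact: jacobsonMr].
Qed.

Fact jacobson_quot_mulA : associative jacobson_quot_mul.
Proof.
move=> u v w; rewrite -[u]reprK -[v]reprK -[w]reprK.
by rewrite -!pi_jacobson_quot_mul mulrA.
Qed.

Fact jacobson_quot_mul1 : left_id jacobson_quot_one jacobson_quot_mul.
Proof. by move=> u; rewrite -[u]reprK -pi_jacobson_quot_mul mul1r. Qed.

Fact jacobson_quot_mulr1 : right_id jacobson_quot_one jacobson_quot_mul.
Proof. by move=> u; rewrite -[u]reprK -pi_jacobson_quot_mul mulr1. Qed.

Fact jacobson_quot_mulDl : left_distributive jacobson_quot_mul +%R.
Proof.
move=> u v w; rewrite -[u]reprK -[v]reprK -[w]reprK.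
by rewrite -pi_addr -!pi_jacobson_quot_mul -pi_addr mulrDl.
Qed.

Fact jacobson_quot_mulDr : right_distributive jacobson_quot_mul +%R.
Proof.
move=> u v w; rewrite -[u]reprK -[v]reprK -[w]reprK.
by rewrite -pi_addr -!pi_jacobson_quot_mul -pi_addr mulrDr.
Qed.

HB.instance Definition _ := GRing.Zmodule_isPzRing.Build Q
  jacobson_quot_mulA jacobson_quot_mul1 jacobson_quot_mulr1
  jacobson_quot_mulDl jacobson_quot_mulDr.

Definition jacobson_pi (x : R) : Q := \pi_Q x.

Fact jacobson_pi_is_zmod_morphism : zmod_morphism jacobson_pi.
Proof. by move=> x y; rewrite /jacobson_pi pi_addr pi_oppr. Qed.

Fact jacobson_pi_is_monoid_morphism : monoid_morphism jacobson_pi.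
Proof. by split=> // x y; apply: pi_jacobson_quot_mul. Qed.

HB.instance Definition _ := GRing.isZmodMorphism.Build R Q jacobson_pi
  jacobson_pi_is_zmod_morphism.
HB.instance Definition _ := GRing.isMonoidMorphism.Build R Q jacobson_pi
  jacobson_pi_is_monoid_morphism.

Lemma jacobson_pi_surj u : exists x, jacobson_pi x = u.
Proof. by exists (repr u); apply: reprK. Qed.

Lemma jacobson_pi_eq0 x : (jacobson_pi x == 0) = (x \in jacobson).
Proof.
rewrite -(rmorph0 jacobson_pi) -[in RHS](subr0 x).
by apply/eqP/idP => /jacobson_quot_eqP.
Qed.

End Jacobson.

(* Main.v *)
(** If [R] is not a D-ring, some zero-divisor [w + g] is not nilpotent, and then
    [g ^ 2] is a nontrivial idempotent [e].  Comparing the decompositions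
    [e = 0 + e = - x + (e + x)] for [x = e r (1 - e)] makes idempotents central.
    Every [e x] and [(1 - e) x] is then a zero-divisor, hence the sum of a
    nilpotent and a very idempotent; this forces [J(R)] to be the set of
    nilpotents and [x ^ 3 = x] in [R / J(R)].  So [6] and all [x ^ 3 - x] are
    nilpotent, which gives periodicity, and idempotents lift modulo [J(R)].
    In [Q = R / J(R)], [6 = 0] splits [Q] as [4 Q * 3 Q] with [3 Q] Boolean; in
    [h Q], for [h <> 1] an idempotent killed by [3], every element is [0], [h]
    or [- h], which leaves the listed rings.
    Conversely, in each listed ring every element is a unit or a very
    idempotent, and in a periodic ring [J(R)] is nil and idempotents lift by
    taking powers. *)

Require Import Defs.
From HB Require Import structures.
From mathcomp Require Import all_boot all_algebra.
From mathcomp Require Import boolp classical_sets.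

Set Implicit Arguments.
Unset Strict Implicit.
Unset Printing Implicit Defensive.

Import GRing.Theory.
Local Open Scope ring_scope.

(** * Ring isomorphisms *)

Section Isomorphisms.
Implicit Types A B C D : pzRingType.

Lemma ring_isomorphicI A B (f : A -> B) :
  {morph f : x y / x + y} -> f 1 = 1 -> {morph f : x y / x * y} ->
  bijective f -> ring_isomorphic A B.
Proof.
move=> fD f1 fM fbij.
have fB : zmod_morphism f.
  by move=> x y; apply: (addIr (f y)); rewrite -fD !subrK.
pose fA := GRing.isZmodMorphism.Build A B f fB.
pose fMM := GRing.isMonoidMorphism.Build A B f (f1, fM).
pose F : {rmorphism A -> B} := HB.pack f fA fMM.
by exists F.
Qed.

Lemma ring_isomorphic_refl A : ring_isomorphic A A.
Proof. by exists idfun; exists id. Qed.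

Lemma ring_isomorphic_sym A B : ring_isomorphic A B -> ring_isomorphic B A.
Proof.
move=> [f [g fK gK]]; apply: (@ring_isomorphicI _ _ g); last by exists f.
- by move=> x y; apply: (can_inj fK); rewrite rmorphD !gK.
- by apply: (can_inj fK); rewrite gK rmorph1.
- by move=> x y; apply: (can_inj fK); rewrite rmorphM !gK.
Qed.

Lemma ring_isomorphic_trans B A C :
  ring_isomorphic A B -> ring_isomorphic B C -> ring_isomorphic A C.
Proof.
move=> [f fbij] [g gbij]; apply: (@ring_isomorphicI _ _ (g \o f)) => /=.
- by move=> x y; rewrite /= !rmorphD.
- by rewrite !rmorph1.
- by move=> x y; rewrite /= !rmorphM.
- exact: bij_comp.
Qed.

Lemma ring_isomorphic_prod A B C D :
  ring_isomorphic A B -> ring_isomorphic C D ->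
  ring_isomorphic (A * C)%type (B * D)%type.
Proof.
move=> [f [f' fK f'K]] [g [g' gK g'K]].
apply: (@ring_isomorphicI _ _ (fun u => (f u.1, g u.2))).
- by move=> [a c] [a' c'] /=; rewrite !rmorphD.
- by rewrite /= !rmorph1.
- by move=> [a c] [a' c'] /=; rewrite !rmorphM.
- by exists (fun u => (f' u.1, g' u.2)) => -[x y] /=; rewrite ?fK ?gK ?f'K ?g'K.
Qed.

(** The map is built from ['Z_3], a residue going to that multiple of [1]; [3 = 0] makes it
    compatible with reduction modulo 3. *)
Lemma isomorphic_Z3 A :
  1 != 0 :> A -> 3%:R = 0 :> A ->
  (forall x : A, [\/ x = 0, x = 1 | x = -1]) -> ring_isomorphic A 'Z_3.
Proof.
move=> nz1 A3 Ax; apply: ring_isomorphic_sym.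
pose f (z : 'Z_3) : A := (nat_of_ord z)%:R.
have fmod n : (n %% 3)%:R = n%:R :> A.
  by rewrite [in RHS](divn_eq n 3) natrD natrM A3 mulr0 add0r.
have f2 : 2%:R = - 1 :> A by apply/eqP; rewrite -addr_eq0 natr1 A3.
apply: (@ring_isomorphicI _ _ f).
- by move=> x y; rewrite /f -natrD; apply: fmod.
- by [].
- by move=> x y; rewrite /f -natrM; apply: fmod.
pose g (x : A) : 'Z_3 := if x == 0 then 0 else if x == 1 then 1 else -1.
have nzN1 : -1 != 0 :> A by rewrite oppr_eq0.
have N11 : (-1 == 1 :> A) = false.
  by apply: contraNF nz1 => /eqP e; rewrite -(addrK 1 1) [1 + 1]f2 {1}e subrr.
exists g => [[[|[|[|//]]] i]|x]; rewrite /f /g.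
- by rewrite eqxx; apply: val_inj.
- by rewrite (negbTE nz1) eqxx; apply: val_inj.
- by rewrite f2 (negbTE nzN1) N11; apply: val_inj.
case: (Ax x) => ->; first by rewrite eqxx.
  by rewrite (negbTE nz1) eqxx.
by rewrite (negbTE nzN1) N11.
Qed.

End Isomorphisms.

(** * Corner rings of central idempotents *)

Section Corner.
Variables (R : pzRingType) (h : R).
Hypotheses (hh : h * h = h) (hC : forall r, h * r = r * h).

Definition corner_pred : pred R := fun x => h * x == x.

Fact corner_zmod_closed : zmod_closed corner_pred.
Proof.
split=> [|x y]; rewrite !unfold_in /corner_pred ?mulr0 // => /eqP hx /eqP hy.
by rewrite mulrBr hx hy.
Qed.

HB.instance Definition _ := GRing.isZmodClosed.Build R corner_pred
  corner_zmod_closed.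

(** The two proofs index the type so that the ring structure with identity [h] can be inferred from
    the type alone. *)
Definition corner of h * h = h & forall r, h * r = r * h : Type :=
  {x : R | corner_pred x}.
Local Notation C := (corner hh hC).

HB.instance Definition _ := [isSub of C for @sval R corner_pred].
HB.instance Definition _ := [Choice of C by <:].
HB.instance Definition _ := [SubChoice_isSubZmodule of C by <:].

Fact corner_valM (u v : C) : corner_pred (val u * val v).
Proof. by rewrite /corner_pred mulrA (eqP (valP u)). Qed.

Fact corner_val1 : corner_pred h.
Proof. exact/eqP. Qed.

Definition corner_mul (u v : C) : C := Sub (val u * val v) (corner_valM u v).
Definition corner_one : C := Sub h corner_val1.

Fact corner_mulA : associative corner_mul.
Proof. by move=> u v w; apply: val_inj; rewrite /= mulrA. Qed.

Fact corner_mul1r : left_id corner_one corner_mul.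
Proof. by move=> u; apply: val_inj; apply/eqP/(valP u). Qed.

Fact corner_mulr1 : right_id corner_one corner_mul.
Proof. by move=> u; apply: val_inj; rewrite /= -hC; apply/eqP/(valP u). Qed.

Fact corner_mulDl : left_distributive corner_mul +%R.
Proof. by move=> u v w; apply: val_inj; rewrite /= mulrDl. Qed.

Fact corner_mulDr : right_distributive corner_mul +%R.
Proof. by move=> u v w; apply: val_inj; rewrite /= mulrDr. Qed.

HB.instance Definition _ := GRing.Zmodule_isPzRing.Build C
  corner_mulA corner_mul1r corner_mulr1 corner_mulDl corner_mulDr.

End Corner.

(** Peirce decomposition: [x] goes to [(h * x, k * x)], and the inverse adds the two components. *)
Lemma isomorphic_corners (R : pzRingType) (h k : R)
    (hh : h * h = h) (hC : forall r, h * r = r * h)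
    (kk : k * k = k) (kC : forall r, k * r = r * k) :
  h + k = 1 -> ring_isomorphic R (corner hh hC * corner kk kC)%type.
Proof.
move=> hk1.
have hk0 : h * k = 0.
  by apply: (addrI (h * h)); rewrite -mulrDr hk1 addr0 mulr1.
have pP (g : R) (gg : g * g = g) x : corner_pred g (g * x).
  by rewrite /corner_pred mulrA gg.
pose f x : corner hh hC * corner kk kC :=
  (Sub (h * x) (pP h hh x), Sub (k * x) (pP k kk x)).
apply: (@ring_isomorphicI _ _ f).
- by move=> x y; congr pair; apply: val_inj; rewrite /= mulrDr.
- by congr pair; apply: val_inj; rewrite /= mulr1.
- move=> x y; congr pair; apply: val_inj => /=.
    by rewrite -[RHS]mulrA [x * (_ * y)]mulrA -(hC x) !mulrA hh.
  by rewrite -[RHS]mulrA [x * (_ * y)]mulrA -(kC x) !mulrA kk.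
exists (fun u => val u.1 + val u.2) => [x|[u v]] /=.
  by rewrite -mulrDl hk1 mul1r.
have hu := eqP (valP u); have kv := eqP (valP v).
congr pair; apply: val_inj; rewrite /= mulrDr.
  by rewrite hu -kv mulrA hk0 mul0r addr0.
by rewrite kv -hu mulrA -hC hk0 mul0r add0r.
Qed.

Lemma corner_isomorphic_Z3 (R : pzRingType) (h : R)
    (hh : h * h = h) (hC : forall r, h * r = r * h) :
  h != 0 -> h *+ 3 = 0 ->
  (forall x, [\/ h * x = 0, h * x = h | h * x = - h]) ->
  ring_isomorphic (corner hh hC) 'Z_3.
Proof.
move=> h0 h3 hx; apply: isomorphic_Z3 => [||u].
- exact: h0.
- exact: val_inj.
by case: (hx (val u)); rewrite (eqP (valP u)) => hu;
  [apply: Or31|apply: Or32|apply: Or33]; apply: val_inj.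
Qed.


(** * Classification of rings with [x ^ 3 = x] *)

Lemma three_torsion_corner (Q : pzRingType) (h : Q) :
  h *+ 3 = 0 -> (forall x, h * (x * x) = h * x \/ h * (x * x) = - (h * x)) ->
  forall x, [\/ h * x = 0, h * x = h | h * x = - h].
Proof.
move=> h3 hP x.
have hx3 y : h * y *+ 3 = 0 by rewrite -mulrnAl h3 mul0r.
have hx2 y : h * y *+ 2 = - (h * y).
  by apply/eqP; rewrite -addr_eq0 -mulrSr hx3.
(* With [z := h * x], apply the hypothesis to [z + h] if [z ^ 2 = z], and to
   [z - h] if [z ^ 2 = - z]; these elements square to [h]. *)
have [zz|zz] := hP x.
  have := hP (x + 1).
  rewrite mulrDl mul1r !mulrDr zz !mulr1 !addrA -mulr2n -mulrSr hx3 add0r.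
  case=> [/esym/eqP|/eqP].
    by rewrite -subr_eq0 addrK => /eqP; apply: Or31.
  rewrite eq_sym opprD subr_eq -mulr2n -[h in h *+ 2]mulr1 hx2 mulr1 eqr_opp.
  by move/eqP; apply: Or32.
have := hP (x - 1).
rewrite mulrBl mul1r !mulrBr zz !mulr1 opprB addrA addrAC.
rewrite -!opprD -mulr2n -mulrSr hx3 oppr0 add0r.
case=> [/esym/eqP|/eqP].
  rewrite subr_eq -mulr2n -[h in h *+ 2]mulr1 hx2 mulr1.
  by move/eqP; apply: Or33.
rewrite eq_sym -subr_eq0 addrAC subrr add0r oppr_eq0.
by move/eqP; apply: Or31.
Qed.

Section Classification.
Variable Q : pzRingType.
Hypotheses (idC : abelian_ring Q) (cube : forall x : Q, x ^+ 3 = x).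
Hypothesis idP : forall h : Q, idempotent_elt h -> h != 1 ->
  forall x, h * (x * x) = h * x \/ h * (x * x) = - (h * x).

(** [cube] at [2] gives [8 = 2], that is [6 = 0]. *)
Let nat_mod6 n : n%:R = (n %% 6)%:R :> Q.
Proof.
have q6 : 6%:R = 0 :> Q.
  by apply: (addrI 2%:R); rewrite addr0 -[RHS]cube -natrX -natrD.
by rewrite [in LHS](divn_eq n 6) natrD natrM q6 mulr0 add0r.
Qed.

(** [4] and [3] are the complementary idempotents that split the integers modulo 6 by the Chinese
    remainder theorem. *)
Let four_idem : 4%:R * 4%:R = 4%:R :> Q.
Proof. by rewrite -natrM nat_mod6. Qed.

Let three_idem : 3%:R * 3%:R = 3%:R :> Q.
Proof. by rewrite -natrM nat_mod6. Qed.

Let four_add_three : 4%:R + 3%:R = 1 :> Q.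
Proof. by rewrite -natrD nat_mod6. Qed.

Let four3 : 4%:R *+ 3 = 0 :> Q.
Proof. by rewrite -mulrnA nat_mod6. Qed.

(** Expanding [(1 + x) ^ 3 = 1 + x] leaves [3 x + 3 x ^ 2 = 0], and [- 3 = 3] modulo 6. *)
Let three_boolean (x : Q) : 3%:R * (x * x) = 3%:R * x.
Proof.
have : 1 + x *+ 3 + x ^+ 2 *+ 3 + x = 1 + x.
  by rewrite [RHS]addrC -[RHS]cube exprD1n !big_ord_recr big_ord0 /= add0r cube.
move/addIr/eqP; rewrite -addrA -subr_eq0 addrAC subrr add0r addrC addr_eq0.
move/eqP; rewrite !mulr_natl expr2 => ->; apply/eqP.
by rewrite eq_sym -addr_eq0 -mulrnDr -mulr_natl nat_mod6 mul0r.
Qed.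

(** The factors are the corners at [4] and at [3]. When [4 = 1], the Boolean factor is the zero
    ring. *)
Let isomorphic_four_three :
  4%:R != 0 :> Q ->
  (forall x : Q, [\/ 4%:R * x = 0, 4%:R * x = 4%:R | 4%:R * x = - 4%:R]) ->
  exists B : pzRingType,
    boolean_ring B /\ ring_isomorphic Q ('Z_3 * B)%type.
Proof.
move=> nz4 Q4; exists (corner three_idem (idC three_idem)); split.
  move=> u; apply: val_inj; rewrite /=.
  by have eu := eqP (valP u); rewrite -{1}eu -mulrA three_boolean eu.
apply: (ring_isomorphic_trans
  (isomorphic_corners four_idem (idC four_idem) three_idem (idC three_idem)
    four_add_three)).
apply: ring_isomorphic_prod; first exact: corner_isomorphic_Z3.
exact: ring_isomorphic_refl.
Qed.

(** If [4 = 0], then [Q] is Boolean; if [4] is neither [0] nor [1], [idP] applies to it. If [4 = 1],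
    then [3 = 0], and either a nontrivial idempotent splits [Q] into two copies of ['Z_3], or [Q] is
    ['Z_3] itself. *)
Lemma tripotent_classification :
  [\/ ring_isomorphic Q ('Z_3 * 'Z_3)%type,
      exists B : pzRingType,
        boolean_ring B /\ ring_isomorphic Q ('Z_3 * B)%type
    | exists B : pzRingType, boolean_ring B /\ ring_isomorphic Q B].
Proof.
have [z4|nz4] := eqVneq (4%:R : Q) 0.
  have three1 := four_add_three; rewrite z4 add0r in three1.
  apply: Or33; exists Q; split; last exact: ring_isomorphic_refl.
  by move=> x; have := three_boolean x; rewrite three1 !mul1r.
have [e4|ne4] := eqVneq (4%:R : Q) 1; last first.
  apply: Or32; apply: isomorphic_four_three => //.
  by apply: three_torsion_corner => //; apply: idP.
have x3 (x : Q) : x *+ 3 = 0 by rewrite -[x]mulr1 -e4 -mulrnAr four3 mulr0.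
have [[g [gg g0 g1]]|nog] :=
    pselect (exists g : Q, [/\ g * g = g, g != 0 & g != 1]).
  have cc : (1 - g) * (1 - g) = 1 - g.
    by rewrite mulrBl mul1r mulrBr mulr1 gg subrr subr0.
  have c0 : 1 - g != 0 by rewrite subr_eq0 eq_sym.
  have c1 : 1 - g != 1 by rewrite -subr_eq0 addrAC subrr add0r oppr_eq0.
  apply: Or31; apply: (ring_isomorphic_trans
    (isomorphic_corners gg (idC gg) cc (idC cc) (subrKC _ _))).
  by apply: ring_isomorphic_prod; apply: corner_isomorphic_Z3 => //;
    apply: three_torsion_corner => //; apply: idP.
have id01 (g : Q) : g * g = g -> g = 0 \/ g = 1.
  move=> gg; have [->|g0] := eqVneq g 0; first by left.
  by have [->|g1] := eqVneq g 1; [right|case: nog; exists g].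
(* [idP] says nothing about the idempotent [1], so the values of [x] are found from the idempotent
   [x * x], which is [0] or [1]. *)
apply: Or32; apply: isomorphic_four_three => // x; rewrite e4 mul1r.
have [|xx|xx] := id01 (x * x).
- by rewrite mulrA -expr2 -exprSr cube.
- by apply: Or31; rewrite -[x]cube exprS expr2 xx mulr0.
(* From [x * x = 1] and [3 = 0], [(x + 1) ^ 2 = 2 x + 2 = - (x + 1)], so [- (x + 1)] is
   idempotent. *)
have [||x1] := id01 (- (x + 1)).
- rewrite mulrNN mulrDl mul1r mulrDr mulr1 xx (addrC 1) -mulr2n.
  by apply/eqP; rewrite -addr_eq0 -mulrSr x3.
- by move/eqP; rewrite oppr_eq0 addr_eq0 => /eqP; apply: Or33.
apply: Or32; apply/eqP; rewrite -subr_eq0.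
by rewrite -[x](addrK 1) -[x + 1]opprK x1 -!opprD -mulr2n -mulrSr x3 oppr0.
Qed.

End Classification.

(** * The listed quotient rings *)

(** The common property of the four listed rings from which the converse is derived; [q * q = - q]
    means that [- q] is idempotent. *)
Definition reduced_unit_or_very_idempotent (A : pzRingType) : Prop :=
  (forall q : A, q * q = 0 -> q = 0) /\
  forall q : A, [\/ exists u, q * u = 1, q * q = q | q * q = - q].

Lemma reduced_unit_or_very_idempotent_iso (A B : pzRingType) :
  ring_isomorphic A B -> reduced_unit_or_very_idempotent B ->
  reduced_unit_or_very_idempotent A.
Proof.
move=> [f [g fK gK]] [redB unitB]; split=> q.
  move=> qq; apply: (can_inj fK); rewrite rmorph0; apply: redB.
  by rewrite -rmorphM qq rmorph0.
case: (unitB (f q)) => [[u fu]|qq|qq].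
- apply: Or31; exists (g u); apply: (can_inj fK).
  by rewrite rmorphM gK fu rmorph1.
- by apply: Or32; apply: (can_inj fK); rewrite rmorphM qq.
- by apply: Or33; apply: (can_inj fK); rewrite rmorphM qq rmorphN.
Qed.

Lemma reduced_field (F : fieldType) : reduced_unit_or_very_idempotent F.
Proof.
split=> q; first by move/eqP; rewrite mulf_eq0 orbb => /eqP.
have [->|q0] := eqVneq q 0; first by apply: Or32; rewrite mulr0.
by apply: Or31; exists q^-1; rewrite divff.
Qed.

Lemma reduced_boolean (B : pzRingType) :
  boolean_ring B -> reduced_unit_or_very_idempotent B.
Proof.
move=> bool; split=> q; last by apply: Or32; apply: bool.
by move=> qq; have := bool q; rewrite /idempotent_elt qq.
Qed.

Lemma Z3_cases (z : 'Z_3) : [\/ z = 0, z = 1 | z = -1].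
Proof.
by case: z => [[|[|[|//]]] i]; [apply: Or31|apply: Or32|apply: Or33];
  apply: val_inj.
Qed.

Lemma Z3_reduced (z : 'Z_3) : z * z = 0 -> z = 0.
Proof. by case: (Z3_cases z) => ->. Qed.

Lemma reduced_Z3_Z3 : reduced_unit_or_very_idempotent ('Z_3 * 'Z_3)%type.
Proof.
split=> -[x y].
  move=> xy0; have x0 : x * x = 0 := congr1 fst xy0.
  have y0 : y * y = 0 := congr1 snd xy0.
  by rewrite (Z3_reduced x0) (Z3_reduced y0).
case: (Z3_cases x) => ->; case: (Z3_cases y) => ->;
  try (by apply: Or32; congr pair; apply: val_inj);
  try (by apply: Or33; congr pair; apply: val_inj);
  (* Only [(1, -1)] and [(-1, 1)] remain, and each is its own inverse. *)
  apply: Or31.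
- by exists (1, -1); congr pair; apply: val_inj.
- by exists (-1, 1); congr pair; apply: val_inj.
Qed.

Lemma reduced_Z3_boolean (B : pzRingType) :
  boolean_ring B -> reduced_unit_or_very_idempotent ('Z_3 * B)%type.
Proof.
move=> bool; split=> -[x b].
  move=> xb0; have x0 : x * x = 0 := congr1 fst xb0.
  have b0 : b * b = 0 := congr1 snd xb0.
  by rewrite (Z3_reduced x0) -(bool b : b * b = b) b0.
(* Since [- b = b], the second coordinate is idempotent with either sign, and the first coordinate
   decides which sign to take. *)
have bN : - b = b.
  have := bool (- b); rewrite /idempotent_elt mulrNN => <-; exact: bool.
case: (Z3_cases x) => ->.
- by apply: Or32; congr pair; [apply: val_inj|apply: bool].
- by apply: Or32; congr pair; [apply: val_inj|apply: bool].
- by apply: Or33; congr pair; [apply: val_inj|rewrite bN; apply: bool].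
Qed.

(** * Nilpotents, idempotents and periodicity *)

Section Elements.
Variable R : pzRingType.
Implicit Types (x y r u w e f : R).

Lemma nilpotent_left_inverse w :
  nilpotent_elt w -> exists u, u * (1 - w) = 1.
Proof.
move=> [n wn]; exists (\sum_(i < n) w ^+ i).
have cw : GRing.comm (1 - w) (\sum_(i < n) w ^+ i).
  apply: commr_sum => i _; apply: commr_sym; apply: commrB; first exact: commr1.
  by apply: commr_sym; apply: commrX.
by rewrite -cw -opprB mulNr -subrX1 wn sub0r opprK.
Qed.

Lemma nilpotentN w : nilpotent_elt w -> nilpotent_elt (- w).
Proof. by move=> [n wn]; exists n; rewrite exprNn wn mulr0. Qed.

Lemma nilpotent_reduced w :
  (forall x, x * x = 0 -> x = 0) -> nilpotent_elt w -> w = 0.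
Proof.
move=> red [n]; elim: n => [|[|n] IHn] wn.
- by rewrite -[w]mul1r -(expr0 w) wn mul0r.
- by rewrite -[w]expr1.
- by apply: IHn; apply: red; rewrite -exprD -addSnnS exprD wn mul0r.
Qed.

Lemma very_idempotentX3 e : very_idempotent e -> e ^+ 3 = e.
Proof.
rewrite /very_idempotent /idempotent_elt mulrNN !exprS expr0 mulr1.
by case=> ee; rewrite !ee // mulrN ee opprK.
Qed.

Lemma very_idempotent_sqr e : very_idempotent e -> idempotent_elt (e * e).
Proof.
rewrite /very_idempotent /idempotent_elt mulrNN.
by case=> ee; rewrite !ee // mulrNN.
Qed.

Lemma very_idempotent_central e :
  abelian_ring R -> very_idempotent e -> forall r, e * r = r * e.
Proof.
move=> idC [ee|ee] r; first exact: idC.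
by apply: oppr_inj; rewrite -mulNr -mulrN; apply: idC.
Qed.

Lemma idempotentC e : e * e = e -> (1 - e) * (1 - e) = 1 - e.
Proof. by move=> ee; rewrite mulrBl mul1r mulrBr mulr1 ee subrr subr0. Qed.

Lemma idempotent_mulC e : e * e = e -> e * (1 - e) = 0.
Proof. by move=> ee; rewrite mulrBr mulr1 ee subrr. Qed.

Lemma idempotentC_mul e : e * e = e -> (1 - e) * e = 0.
Proof. by move=> ee; rewrite mulrBl mul1r ee subrr. Qed.

Lemma zero_divisor_central_idempotent e x :
  e * e = e -> (forall r, e * r = r * e) -> e != 1 -> zero_divisor (e * x).
Proof.
move=> ee eC e1; exists (1 - e), (1 - e); split; rewrite ?subr_eq0 1?eq_sym //.
  by rewrite eC -mulrA idempotent_mulC // mulr0.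
by rewrite mulrA idempotentC_mul // mul0r.
Qed.

Lemma idempotent_power (a : R) (m n : nat) :
  m <> n -> a ^+ m = a ^+ n -> exists k, a ^+ k.+1 * a ^+ k.+1 = a ^+ k.+1.
Proof.
suff key i j : (i < j)%N -> a ^+ i = a ^+ j ->
    exists k, a ^+ k.+1 * a ^+ k.+1 = a ^+ k.+1.
  move=> /eqP; rewrite neq_ltn => /orP[] lt_mn amn.
    exact: (key m n).
  exact: (key n m).
move: i j => {}m {}n lt_mn amn; set d := (n - m)%N.
have d_gt0 : (0 < d)%N by rewrite subn_gt0.
have am j : a ^+ (m + j * d) = a ^+ m.
  elim: j => [|j IHj]; first by rewrite addn0.
  by rewrite mulSn addnCA exprD IHj -exprD subnK // ltnW.
have shift i j : (m <= i)%N -> a ^+ (i + j * d) = a ^+ i.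
  by move=> mi; rewrite -(subnK mi) -addnA exprD am -exprD.
(* The exponent [m.+1 * d] is a positive multiple of the period [d] and at least [m], so doubling it
   does not change the power. *)
exists (m.+1 * d).-1; rewrite prednK ?muln_gt0 // -exprD shift //.
by apply: leq_trans (leqnSn m) _; apply: leq_pmulr.
Qed.

Lemma left_inverse_nilpotent u w : nilpotent_elt w -> u * w = 1 -> 1 = 0 :> R.
Proof.
move=> [n wn] uw1.
have ukw k : u ^+ k * w ^+ k = 1.
  elim: k => [|k IHk]; first by rewrite mulr1.
  by rewrite exprSr exprS mulrA -(mulrA _ u) uw1 mulr1.
by rewrite -(ukw n) wn mulr0.
Qed.

(** A zero-divisor decomposes as [a + 0], and any decomposition [w + e] has [e ^ 2 = 0]: an
    idempotent [e ^ 2] other than [0] and [1] would be a zero-divisor, hence nilpotent. If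
    [e ^ 2 = 1], then [e] is [1] or [-1], and [w = a - e] is nilpotent and left invertible, so the
    ring is trivial. *)
Lemma D_ring_clean : D_ring R -> uniquely_weakly_D_nil_clean R.
Proof.
move=> D a /D nil_a.
have key w e : nilpotent_elt w -> very_idempotent e -> a = w + e -> e ^+ 2 = 0.
  move=> nil_w vi_e awe; have ff := very_idempotent_sqr vi_e.
  have [f1|f1] := eqVneq (e * e) 1; last first.
    have [f0|f0] := eqVneq (e * e) 0; first by rewrite expr2.
    have [|n] := D (e * e).
      exists (1 - e * e), (1 - e * e); split; rewrite ?subr_eq0 1?eq_sym //.
        exact: idempotent_mulC.
      exact: idempotentC_mul.
    move=> fn; rewrite expr2 -[RHS](mulr0 (e * e)) -fn.
    by elim: n {fn} => [|n IHn]; rewrite ?mulr1 // exprS mulrA ff.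
  suff R0 : 1 = 0 :> R by rewrite expr2 f1.
  have [u u1] : exists u, u * - w = 1 \/ u * w = 1.
    case: vi_e => [|]; rewrite /idempotent_elt ?mulrNN f1 => e1.
      have [u u1] := nilpotent_left_inverse nil_a.
      by exists u; left; rewrite -u1 awe -e1 opprD addrCA subrr addr0.
    have [u u1] := nilpotent_left_inverse (nilpotentN nil_a).
    by exists u; right; rewrite -u1 awe opprK e1 addrC addrK.
  by case: u1; apply: left_inverse_nilpotent => //; apply: nilpotentN.
split.
  exists a, 0; split; rewrite ?addr0 //.
  by left; rewrite /idempotent_elt mulr0.
move=> w1 e1 w2 e2 nil_w1 vi_e1 a1 nil_w2 vi_e2 a2.
by rewrite (key w1 e1) // (key w2 e2).
Qed.

(* [(1 + n)^c = 1 + n (n q)] when [c = 0] in the ring, so raising to the power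
   [c] halves the exponent [j] for which [z n^j = 0]. *)
Lemma unipotent_torsion (z n : R) (c j : nat) :
  (0 < c)%N -> c%:R = 0 :> R -> z * n ^+ j = 0 ->
  exists2 m, (0 < m)%N & z * (1 + n) ^+ m = z.
Proof.
move=> c_gt0 c0; elim/ltn_ind: j n => -[|[|j]] IHj n zn.
(* Halving rounds up and fixes [1], so the exponents [0] and [1] are both base cases. *)
- by exists 1%N => //; rewrite -[z]mulr1 zn mul0r.
- by exists 1%N => //; rewrite expr1 mulrDr mulr1 -[n]expr1 zn addr0.
have [q [nq qE]] : exists q, GRing.comm n q /\ (1 + n) ^+ c = 1 + n * (n * q).
  suff [q [nq qE]] : exists q,
      GRing.comm n q /\ (1 + n) ^+ c = 1 + n *+ c + n * (n * q).
    by exists q; split=> //; rewrite qE -mulr_natl c0 mul0r addr0.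
  elim: (c) => [|k [q [nq qE]]].
    by exists 0; split; [exact: commr0|rewrite !mulr0 !addr0].
  (* The factor of [n ^ 2] in [(1 + k n + n ^ 2 q) (1 + n)]. *)
  exists (k%:R + q + q * n); split.
    apply: commrD; last by apply: commrM.
    by apply: commrD => //; apply: commr_nat.
  have -> : n * (n * (k%:R + q + q * n)) =
      n *+ k * n + (n * (n * q) + n * (n * q) * n).
    by rewrite !mulrDr mulrnAl mulr_natr mulrnAr !mulrA addrA.
  rewrite exprSr qE !mulrDr !mulr1 !mulrDl mul1r mulrSr !addrA.
  by rewrite (addrAC _ _ n); congr (_ + _); apply: addrAC.
have [||m m_gt0 zm] := IHj (uphalf j.+2) _ (n * (n * q)).
- by rewrite ltn_uphalf_double -addnn !addSn !addnS !ltnS leq_addl.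
- rewrite mulrA exprMn_comm.
    2: by apply: commr_sym; apply: commrM; apply: commr_sym.
  have le_j : (j.+2 <= 2 * uphalf j.+2)%N by rewrite mul2n -leq_uphalf_double.
  by rewrite -expr2 -exprM -(subnKC le_j) exprD -mulrA [LHS]mulrA zn mul0r.
exists (c * m)%N; first by rewrite muln_gt0 c_gt0.
by rewrite exprM qE.
Qed.

(** [6 = 2 ^ 3 - 2] is nilpotent, so some [6 ^ k] vanishes in [R]. As [x ^ j (x ^ 2 - 1) ^ j = (x ^
    3 - x) ^ j = 0], [unipotent_torsion] with [n = x ^ 2 - 1] yields [x ^ j (x ^ 2) ^ m = x ^ j]. *)
Lemma periodic_of_nilpotent :
  (forall x, nilpotent_elt (x ^+ 3 - x)) -> periodic_ring R.
Proof.
move=> nil3 x.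
have [k k0] := nil3 2%:R.
have six : 2%:R ^+ 3 - 2%:R = 6%:R :> R by rewrite -natrX (natrD _ 6 2) addrK.
have c0 : (6 ^ k)%:R = 0 :> R by rewrite natrX -six.
have [j xj] := nil3 x.
have [|||m m_gt0 xm] := @unipotent_torsion (x ^+ j) (x ^+ 2 - 1) (6 ^ k) j.
- by rewrite expn_gt0.
- by [].
- rewrite -exprMn_comm; last by apply: commrB; [apply: commrX|apply: commr1].
  by rewrite mulrBr mulr1 -exprS.
exists (j + 2 * m)%N, j; split.
  by apply/eqP; rewrite -[X in _ != X]addn0 eqn_add2l muln_eq0 -lt0n m_gt0.
by rewrite exprD exprM -{2}xm addrC subrK.
Qed.

End Elements.

(** * The Jacobson radical and the converse *)

Section Jacobson.
Variable R : pzRingType.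
Implicit Types (x y r u w e f : R) (I K : set R).
Local Open Scope classical_set_scope.

Lemma left_idealD K x y : left_ideal K -> K x -> K y -> K (x + y).
Proof.
move=> [K0 KB _] Kx Ky.
by rewrite -[y]opprK; apply: (KB) => //; rewrite -sub0r; apply: KB.
Qed.

Lemma left_ideal_setT K : left_ideal K -> K 1 -> K = setT.
Proof.
move=> [_ _ KM] K1; apply/seteqP; split=> // y _.
by rewrite -[y]mulr1; apply: KM.
Qed.

Lemma maximal_left_idealP K :
  left_ideal K -> ~ K 1 -> exists2 M, maximal_left_ideal M & K `<=` M.
Proof.
move=> [K0 KB KM] K1.
(* Containing [K] is required only of nonempty [I], so that the union of the empty chain satisfies
   [P]. *)
pose P I := [/\ ~ I 1, forall x y, I x -> I y -> I (x - y),
                forall r x, I x -> I (r * x) & I !=set0 -> K `<=` I].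
have PK : P K by split=> // _ y.
have [M [[M1 MB MM MK] maxM]] : exists M, P M /\ forall I, M `<` I -> ~ P I.
  apply: Zorn_bigcup => F FP Ftot; split.
  - by move=> [I FI I1]; case: (FP _ FI).
  - move=> x y [I FI Ix] [I' FI' Iy].
    have [II'|I'I] := Ftot _ _ FI FI'.
      by exists I' => //; case: (FP _ FI') => _ + _ _; apply => //; apply: II'.
    by exists I => //; case: (FP _ FI) => _ + _ _; apply => //; apply: I'I.
  - by move=> r x [I FI Ix]; exists I => //; case: (FP _ FI) => _ _ + _; apply.
  - move=> [x [I FI Ix]] y Ky; exists I => //.
    by case: (FP _ FI) => _ _ _; apply => //; exists x.
have sKM : K `<=` M.
  apply: MK; apply/set0P/eqP => M0; apply: (maxM K) => //.
  by split; [rewrite M0|move=> /(_ 0 K0); rewrite M0].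
exists M => //; split.
- by split=> //; apply: sKM.
- by move=> MT; apply: M1; rewrite MT.
move=> I idI sMI.
have [/(left_ideal_setT idI)|I1] := pselect (I 1); first by right.
have [I0 IB IM] := idI.
left; apply/seteqP; split=> //; apply/not_notP => nIM.
apply: (maxM I) => //; split=> // _; exact: subset_trans sMI.
Qed.

(** Otherwise the left ideal generated by [1 - x] lies in a maximal one, which also contains [x],
    hence [1]. *)
Lemma jacobson_left_inverse x :
  x \in @jacobson R -> exists u, u * (1 - x) = 1.
Proof.
move=> /jacobsonP xJ; apply/not_notP => nu.
pose K : set R := [set u * (1 - x) | u in setT].
have idK : left_ideal K.
  split; first by exists 0 => //; rewrite mul0r.
    by move=> _ _ [u _ <-] [v _ <-]; exists (u - v) => //; rewrite mulrBl.
  by move=> r _ [u _ <-]; exists (r * u) => //; rewrite mulrA.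
have [|M maxM sKM] := maximal_left_idealP idK.
  by move=> [u _ u1]; apply: nu; exists u.
have Mx := xJ M maxM.
have [idM MT _] := maxM; apply: MT; apply: left_ideal_setT => //.
rewrite -(subrK x 1); apply: left_idealD => //.
by apply: sKM; exists 1 => //; rewrite mul1r.
Qed.

(** If a maximal left ideal [M] misses [x], then [1 = m + r * x] with [m] in [M], and
    [m = 1 - r * x] is left invertible. *)
Lemma jacobsonI x :
  (forall r, exists u, u * (1 - r * x) = 1) -> x \in @jacobson R.
Proof.
move=> xU; apply/jacobsonP => M [idM MT Mmax]; have [M0 MB MM] := idM.
pose K : set R := [set y | exists m r, M m /\ y = m + r * x].
have idK : left_ideal K.
  split; first by exists 0, 0; rewrite mul0r addr0.
    move=> _ _ [m [r [Mm ->]]] [m' [r' [Mm' ->]]]; exists (m - m'), (r - r').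
    by split; [apply: MB|rewrite mulrBl opprD addrACA].
  move=> s _ [m [r [Mm ->]]]; exists (s * m), (s * r).
  by split; [apply: MM|rewrite mulrDr mulrA].
have sMK : M `<=` K by move=> m Mm; exists m, 0; rewrite mul0r addr0.
have [<-|KT] := Mmax K idK sMK; first by exists 0, 1; rewrite add0r mul1r.
have [m [r [Mm m1]]] : K 1 by rewrite KT.
have [u u1] := xU r; case: MT; apply: left_ideal_setT => //.
by rewrite -u1; apply: MM; rewrite m1 addrK.
Qed.

(** [1 - e] is left invertible and [(1 - e) * e = 0]. *)
Lemma idempotent_jacobson e : e * e = e -> e \in @jacobson R -> e = 0.
Proof.
move=> ee /jacobson_left_inverse [u u1].
by rewrite -[e]mul1r -u1 -mulrA mulrBl mul1r ee subrr mulr0.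
Qed.

Lemma periodic_jacobson_nil x :
  periodic_ring R -> x \in @jacobson R -> nilpotent_elt x.
Proof.
move=> per xJ; have [m [n [mn /(idempotent_power mn) [k xk]]]] := per x.
exists k.+1; apply: idempotent_jacobson => //.
by rewrite exprSr; apply: jacobsonMl.
Qed.

Lemma idempotent_lift (q : jacobson_quot R) :
  periodic_ring R -> q * q = q ->
  exists e : R, e * e = e /\ jacobson_pi e = q.
Proof.
move=> per qq; have [x xq] := jacobson_pi_surj q.
have [m [n [mn /(idempotent_power mn) [k xk]]]] := per x.
exists (x ^+ k.+1); split=> //; rewrite rmorphXn /= xq.
by elim: k {xk} => [|k IHk]; rewrite ?expr1 // exprS IHk.
Qed.

Lemma jacobson_piP x y : jacobson_pi x = jacobson_pi y -> x - y \in @jacobson R.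
Proof. by move=> xy; rewrite -jacobson_pi_eq0 rmorphB /= xy subrr. Qed.

Lemma clean_of_jacobson_quot :
  abelian_ring R -> periodic_ring R ->
  reduced_unit_or_very_idempotent (jacobson_quot R) ->
  uniquely_weakly_D_nil_clean R.
Proof.
move=> idC per [redQ unitQ] a [b [c [_ c0 _ ca0]]].
have nil x y : jacobson_pi x = jacobson_pi y -> nilpotent_elt (x - y).
  by move=> /jacobson_piP; apply: periodic_jacobson_nil.
split.
  have [[q aq]|aa|aa] := unitQ (jacobson_pi a).
  - have [v vq] := jacobson_pi_surj q.
    have [|n] := nil 1 (a * v).
      by rewrite rmorph1 rmorphM /= vq aq.
    (* If the image of [a] were right invertible, [1 - a * v] would be nilpotent while fixing the
       nonzero [c] under right multiplication. *)
    have cE : c * (1 - a * v) = c by rewrite mulrBr mulr1 mulrA ca0 mul0r subr0.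
    have cX k : c * (1 - a * v) ^+ k = c.
      by elim: k => [|k IHk]; rewrite ?mulr1 // exprS mulrA cE.
    by move=> n0; rewrite -(cX n) n0 mulr0 eqxx in c0.
  - have [e [ee eq]] := idempotent_lift per aa.
    by exists (a - e), e; split; [apply: nil|left|rewrite subrK].
  - have [|e [ee eq]] := @idempotent_lift (- jacobson_pi a) per.
      by rewrite mulrNN.
    exists (a + e), (- e); split; last by rewrite addrK.
      by rewrite -[e]opprK; apply: nil; rewrite rmorphN /= eq opprK.
    by right; rewrite opprK.
move=> w1 e1 w2 e2 nil_w1 vi_e1 a1 nil_w2 vi_e2 a2.
have pi_nil w : nilpotent_elt w -> jacobson_pi w = 0.
  move=> [n wn]; have : nilpotent_elt (jacobson_pi w).
    by exists n; rewrite -rmorphXn wn rmorph0.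
  by apply: nilpotent_reduced.
have pi12 : jacobson_pi e1 = jacobson_pi e2.
  move: (congr1 (@jacobson_pi R) a1); rewrite {1}a2 !rmorphD /=.
  by rewrite (pi_nil w1) // (pi_nil w2) // !add0r.
have ff1 := very_idempotent_sqr vi_e1; have ff2 := very_idempotent_sqr vi_e2.
(* Congruent idempotents coincide: [f * (1 - g)] is an idempotent in the radical, so [f = f * g],
   and symmetrically [g = g * f]. *)
have key f g : f * f = f -> g * g = g -> jacobson_pi f = jacobson_pi g ->
    f * g = f.
  move=> ff gg fg; have cg := idempotentC gg.
  have /eqP : f * (1 - g) = 0.
    apply: idempotent_jacobson.
      by rewrite mulrA -(mulrA f) -(idC f) // !mulrA ff -mulrA cg.
    rewrite -jacobson_pi_eq0 rmorphM rmorphB rmorph1 /= fg mulrBr mulr1.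
    by rewrite -rmorphM gg subrr.
  by rewrite mulrBr mulr1 subr_eq0 => /eqP.
rewrite !expr2 -(key (e1 * e1) (e2 * e2)) ?rmorphM /= ?pi12 //.
by rewrite idC // key // !rmorphM /= pi12.
Qed.

(** * Idempotents and nilpotents of uniquely weakly D-nil-clean rings *)

Lemma abelian_of_clean : uniquely_weakly_D_nil_clean R -> abelian_ring R.
Proof.
move=> clean e ee r; have [->|e1] := eqVneq e 1; first by rewrite mul1r mulr1.
have [_ uniq] : uniquely_weakly_nil_clean e.
  apply: clean; exists (1 - e), (1 - e); split; rewrite ?subr_eq0 1?eq_sym //.
    exact: idempotent_mulC.
  exact: idempotentC_mul.
(* [e = 0 + e = - x + (e + x)] are two decompositions of [e]. *)
have key x : x * x = 0 -> e * x + x * e = x -> x = 0.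
  move=> xx exxe; have exex : (e + x) * (e + x) = e + x.
    by rewrite mulrDl !mulrDr ee xx addr0 -addrA exxe.
  apply: (addrI e); rewrite addr0 -exex -{3}ee -!expr2.
  apply: (uniq (- x) (e + x) 0 e); rewrite ?add0r ?addNKr //.
  - by exists 2%N; rewrite expr2 mulrNN.
  - by left.
  - by rewrite addrCA addNr addr0.
  - by exists 1%N.
  - by left.
have ec := idempotent_mulC ee; have ce := idempotentC_mul ee.
have er : e * (r * (1 - e)) = 0.
  apply: key; rewrite -!mulrA.
    by rewrite (mulrA (1 - e) e) ce !(mul0r, mulr0).
  by rewrite ce !mulr0 addr0 mulrA ee.
have re : (1 - e) * (r * e) = 0.
  apply: key; rewrite -!mulrA ?ee.
    by rewrite (mulrA e (1 - e)) ec !(mul0r, mulr0).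
  by rewrite (mulrA e (1 - e)) ec mul0r add0r.
(* Both off-diagonal Peirce components of [r] vanish, so [e * r = e * r * e = r * e]. *)
move/eqP: er; rewrite mulrBr mulr1 mulrBr subr_eq0 => /eqP ->.
by move/eqP: re; rewrite mulrBl mul1r subr_eq0 => /eqP <-.
Qed.

(** If all idempotents were trivial, a zero-divisor [w + e] would have [e] equal to [0], [1] or
    [-1]; the last two make it left invertible, so it would be the nilpotent [w]. *)
Lemma nontrivial_idempotent :
  uniquely_weakly_D_nil_clean R -> ~ D_ring R ->
  exists e : R, [/\ e * e = e, e != 0 & e != 1].
Proof.
move=> clean nD; apply/not_notP => noe; apply: nD => a zda.
have [[w [e [nil_w vi_e awe]]] _] := clean a zda.
have [b [c [b0 _ ab _]]] := zda.
have trivial f : f * f = f -> f = 0 \/ f = 1.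
  move=> ff; have [|f0] := eqVneq f 0; first by left.
  by have [|f1] := eqVneq f 1; [right|case: noe; exists f].
have unit u : ~ u * a = 1.
  by move=> ua; case/eqP: b0; rewrite -[b]mul1r -ua -mulrA ab mulr0.
case: vi_e => /trivial [] e0.
- by rewrite awe e0 addr0.
- have [u u1] := nilpotent_left_inverse (nilpotentN nil_w).
  by case: (unit u); rewrite awe e0 addrC -[w]opprK.
- by rewrite awe -[e]opprK e0 oppr0 addr0.
- have [u u1] := nilpotent_left_inverse nil_w.
  by case: (unit (- u)); rewrite mulNr -mulrN awe opprD e0 addrC.
Qed.

(** [e] kills [x ^ m] and [1 - e] kills [x ^ n], so both kill [x ^ (m + n)]. *)
Lemma nilpotent_split e x :
  e * e = e -> (forall r, e * r = r * e) ->
  nilpotent_elt (e * x) -> nilpotent_elt ((1 - e) * x) -> nilpotent_elt x.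
Proof.
move=> ee eC [m em] [n cn]; exists (m + n)%N.
have pow f k : f * f = f -> (forall r, f * r = r * f) ->
    f * (f * x) ^+ k = f * x ^+ k.
  move=> ff fC; elim: k => [//|k IHk].
  by rewrite !exprSr mulrA IHk mulrA -(mulrA f) -fC !mulrA ff.
have cC r : (1 - e) * r = r * (1 - e).
  by rewrite mulrBl mulrBr mul1r mulr1 eC.
have exm : e * x ^+ m = 0 by rewrite -pow // em mulr0.
have cxn : (1 - e) * x ^+ n = 0.
  by rewrite -pow ?cn ?mulr0 //; apply: idempotentC.
rewrite -[_ ^+ _]mul1r -(subrK e 1) mulrDl exprD [e * _]mulrA exm mul0r addr0.
by rewrite -exprD addnC exprD mulrA cxn mul0r.
Qed.

(** [(n + g) * g] is [(n + 1) * g] or [(n - 1) * g], so inverting the unit gives [v * w * g = g]. As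
    [g] is central, iteration gives [g = v ^ j * g * w ^ j]. *)
Lemma very_idempotent_nilpotent_mul w r n g :
  abelian_ring R -> nilpotent_elt w -> nilpotent_elt n -> very_idempotent g ->
  r * w = n + g -> g = 0.
Proof.
move=> idC [k wk] nil_n vi_g rw; have gC := very_idempotent_central idC vi_g.
have [v vwg] : exists v, v * w * g = g.
  case: vi_g => gg.
    have [u u1] := nilpotent_left_inverse (nilpotentN nil_n).
    exists (u * r); rewrite -(mulrA u) rw -mulrA mulrDl gg.
    by rewrite -{2}[g]mul1r -mulrDl mulrA addrC -[n]opprK u1 mul1r.
  have [u u1] := nilpotent_left_inverse nil_n.
  exists (- u * r); rewrite -(mulrA (- u)) rw -mulrA mulrDl.
  have -> : g * g = - g by move: gg; rewrite /idempotent_elt mulrNN.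
  by rewrite mulNr -mulrN opprD opprK addrC -{1}[g]mul1r -mulrBl mulrA u1 mul1r.
have gE j : g = v ^+ j * g * w ^+ j.
  elim: j => [|j IHj]; first by rewrite mul1r mulr1.
  rewrite {1}IHj -{1}vwg exprSr exprS -[v * w * g]mulrA -gC !mulrA.
  done.
by rewrite (gE k) wk mulr0.
Qed.

(** * The radical in the presence of a nontrivial idempotent *)

Section NontrivialIdempotent.
Hypothesis clean : uniquely_weakly_D_nil_clean R.
Variable e : R.
Hypotheses (ee : e * e = e) (e0 : e != 0) (e1 : e != 1).

Let idC := abelian_of_clean clean.
Let cc := idempotentC ee.
Let c1 : 1 - e != 1.
Proof. by rewrite -subr_eq0 addrAC subrr add0r oppr_eq0. Qed.

Let clean_mul f x : f * f = f -> f != 1 ->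
  exists w g, [/\ nilpotent_elt w, very_idempotent g & f * x = w + g].
Proof.
move=> ff f1.
by have [] := clean (zero_divisor_central_idempotent x ff (idC ff) f1).
Qed.

(** For [f] equal to [e] or [1 - e], the very idempotent part of [f * (r * w)] vanishes by
    [very_idempotent_nilpotent_mul]. *)
Lemma nilpotent_mulr w r : nilpotent_elt w -> nilpotent_elt (r * w).
Proof.
move=> nil_w.
have key f : f * f = f -> f != 1 -> nilpotent_elt (f * (r * w)).
  move=> ff f1; have [n [g [nil_n vi_g frw]]] := clean_mul (r * w) ff f1.
  rewrite frw (@very_idempotent_nilpotent_mul w (f * r) n g) ?addr0 //.
  by rewrite -mulrA.
by apply: (nilpotent_split ee (idC ee)); apply: key.
Qed.

Lemma nilpotent_jacobson w : nilpotent_elt w -> w \in @jacobson R.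
Proof.
move=> nil_w; apply: jacobsonI => r.
exact/nilpotent_left_inverse/nilpotent_mulr.
Qed.

(** In [f * x = n + g] both [f * x] and [n] lie in the radical, hence so does [g], and a very
    idempotent in the radical is [0]. *)
Lemma jacobson_nilpotent x : x \in @jacobson R -> nilpotent_elt x.
Proof.
move=> xJ.
have key f : f * f = f -> f != 1 -> nilpotent_elt (f * x).
  move=> ff f1; have [n [g [nil_n vi_g fx]]] := clean_mul x ff f1.
  have /eqP gJ : jacobson_pi g == 0.
    rewrite -[g](addKr n) -fx rmorphD rmorphN rmorphM /=.
    have /eqP -> : jacobson_pi n == 0.
      by rewrite jacobson_pi_eq0; apply: nilpotent_jacobson.
    have /eqP -> : jacobson_pi x == 0 by rewrite jacobson_pi_eq0.
    by rewrite mulr0 oppr0 addr0.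
  suff g0 : g = 0 by rewrite fx g0 addr0.
  case: vi_g => gg.
    by apply: idempotent_jacobson; rewrite // -jacobson_pi_eq0 gJ.
  apply: oppr_inj; rewrite oppr0.
  apply: idempotent_jacobson => //.
  by rewrite -jacobson_pi_eq0 rmorphN /= gJ oppr0.
by apply: (nilpotent_split ee (idC ee)); apply: key.
Qed.

Lemma jacobson_pi_clean f x : f * f = f -> f != 1 ->
  exists2 g, very_idempotent g & jacobson_pi (f * x) = jacobson_pi g.
Proof.
move=> ff f1; have [n [g [nil_n vi_g ->]]] := clean_mul x ff f1.
exists g => //; rewrite rmorphD /=.
have /eqP -> : jacobson_pi n == 0.
  by rewrite jacobson_pi_eq0; apply: nilpotent_jacobson.
by rewrite add0r.
Qed.

Lemma jacobson_quotX3 (q : jacobson_quot R) : q ^+ 3 = q.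
Proof.
have [x <-] := jacobson_pi_surj q; rewrite -rmorphXn.
have key f : f * f = f -> f != 1 ->
    jacobson_pi (f * x ^+ 3) = jacobson_pi (f * x).
  move=> ff f1; have [g vi_g fx] := jacobson_pi_clean x ff f1.
  have -> : f * x ^+ 3 = (f * x) ^+ 3.
    rewrite exprMn_comm; last exact: idC.
    by rewrite [f ^+ 3]exprS expr2 ff ff.
  by rewrite fx rmorphXn /= fx -rmorphXn very_idempotentX3.
have split y : y = (1 - e) * y + e * y by rewrite -mulrDl subrK mul1r.
rewrite (split (x ^+ 3)) [in RHS](split x) !rmorphD /=.
by rewrite (key e) // (key (1 - e)).
Qed.

End NontrivialIdempotent.

End Jacobson.

(** * The equivalence *)

Lemma classification_of_clean (R : pzRingType) :
  uniquely_weakly_D_nil_clean R -> ~ D_ring R ->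
  [/\ abelian_ring R, periodic_ring R
    & [\/ ring_isomorphic (jacobson_quot R) ('Z_3 * 'Z_3)%type,
          exists B : pzRingType,
            boolean_ring B /\ ring_isomorphic (jacobson_quot R) ('Z_3 * B)%type
        | exists B : pzRingType,
            boolean_ring B /\ ring_isomorphic (jacobson_quot R) B]].
Proof.
move=> clean nD; have idC := abelian_of_clean clean.
have [e [ee e0 e1]] := nontrivial_idempotent clean nD.
have cube := jacobson_quotX3 clean ee e0 e1.
have per : periodic_ring R.
  apply: periodic_of_nilpotent => x.
  apply: (jacobson_nilpotent clean ee e0 e1).
  by apply: jacobson_piP; rewrite rmorphXn /= cube.
have idCQ : abelian_ring (jacobson_quot R).
  move=> q /(idempotent_lift per) [f [ff <-]] r.
  by have [x <-] := jacobson_pi_surj r; rewrite -!rmorphM idC.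
split=> //; apply: tripotent_classification => // q qq q1 r.
(* For the last hypothesis of the classification, [q] lifts to an idempotent [f] other than [1], so
   [q * r] is the image of a very idempotent [g]. *)
have [f [ff fq]] := idempotent_lift per qq.
have f1 : f != 1 by apply: contra_neq q1 => f1; rewrite -fq f1 rmorph1.
have [x xr] := jacobson_pi_surj r.
have [g vi_g fx] := jacobson_pi_clean clean ee e0 e1 x ff f1.
have qr : q * r = jacobson_pi g by rewrite -fx rmorphM /= fq xr.
have -> : q * (r * r) = (q * r) * (q * r).
  by rewrite -[RHS]mulrA [r * (q * r)]mulrA -(idCQ q) // !mulrA qq.
rewrite qr -rmorphM; case: vi_g => gg; [left|right]; first by rewrite gg.
by move: gg; rewrite /idempotent_elt mulrNN => ->; rewrite rmorphN.
Qed.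

Theorem theorem3p4 (R : pzRingType) :
  uniquely_weakly_D_nil_clean R <->
  D_ring R \/
  [/\ abelian_ring R,
      periodic_ring R
    & [\/ exists F : fieldType, ring_isomorphic (jacobson_quot R) F,
          ring_isomorphic (jacobson_quot R) ('Z_3 * 'Z_3)%type,
          exists B : pzRingType,
            boolean_ring B /\ ring_isomorphic (jacobson_quot R) ('Z_3 * B)%type
        | exists B : pzRingType,
            boolean_ring B /\ ring_isomorphic (jacobson_quot R) B]].
Proof.
split=> [clean|[/D_ring_clean //|[idC per Q]]].
  have [D|nD] := pselect (D_ring R); [by left|right].
  have [idC per Q] := classification_of_clean clean nD; split=> //.
  by case: Q; [apply: Or42|apply: Or43|apply: Or44].
apply: clean_of_jacobson_quot => //.
case: Q => [[F isoF]|iso3|[B [bool isoB]]|[B [bool isoB]]].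
- exact: reduced_unit_or_very_idempotent_iso isoF (reduced_field F).
- exact: reduced_unit_or_very_idempotent_iso iso3 reduced_Z3_Z3.
- exact: reduced_unit_or_very_idempotent_iso isoB (reduced_Z3_boolean bool).
- exact: reduced_unit_or_very_idempotent_iso isoB (reduced_boolean bool).
Qed.
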